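(* Let $\lambda:J\to[0,1]$ and let $\lambda_n=\lambda$ for every $n\ge1$. Assume that for every convex function $f\in D$ the sequence $(L_n(f))_{n\ge1}$ is decreasing. Then $(L_{n,\lambda}(f))_{n\ge1}$ is also decreasing for every convex function $f\in D$.
   Context: $I$ is an interval of the real line and $J$ a subinterval of $I$. $F(J)$ is the space of all real functions on $J$, $C(I)$ the space of continuous real functions on $I$. $\mathbf 1$ is the constant function $1$ and $e_1(x)=x$. For $f\in C(I)$, $\alpha\in[0,1]$, $x\in I$, put $f_{\alpha,x}(t)=f(\alpha t+(1-\alpha)x)$, $t\in I$. $D$ is a sublattice (linear sublattice) of $C(I)$ such that $\mathbf 1,e_1\in D$ and $f_{\alpha,x}\in D$ for all $f\in D$, $x\in I$, $\alpha\in[0,1]$. $(L_n)_{n\ge1}$ is a sequence of positive linear operators $L_n:D\to F(J)$ with $L_n(\mathbf 1)=\mathbf 1$; $L_0(f):=f_{|J}$. For a function $\lambda:J\to[0,1]$, $n\ge1$, $f\in D$, $x\in J$, $$L_{n,\lambda}(f)(x):=\sum_{p=0}^n\binom np\lambda(x)^p(1-\lambda(x))^{n-p}L_p(f_{p/n,x})(x)$$ (with $0^0=1$). A sequence of functions $(h_n)$ on $J$ is decreasing if $h_{n+1}\le h_n$ pointwise on $J$ for all $n\ge 1$. *)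

(* Defs.v *)
From mathcomp Require Import all_boot all_order all_algebra.
From mathcomp Require Import all_classical all_reals all_analysis.
From mathcomp Require Import ring lra.
Import Order.TTheory GRing.Theory Num.Theory.
Import numFieldNormedType.Exports.

Set Implicit Arguments.
Unset Strict Implicit.
Unset Printing Implicit Defensive.

Local Open Scope classical_set_scope.
Local Open Scope ring_scope.
Local Open Scope convex_scope.

(* Real functions on a set I are elements of I -> R^o, where I is coerced to  *)
(* the subtype {x | x \in I}; they form an lmodType, and `continuous` refers  *)
(* to the topology induced by R on I.                                         *)

Section Definitions.
Context {R : realType}.

Definition continuous_functions (I : set R) : set (I -> R^o) :=
  [set f | continuous f].

(* The extension of f by 0 outside I. It only serves to evaluate f at a real  *)
(* number known to be in I without carrying the membership proof around.      *)
Definition ext (I : set R) (f : I -> R^o) : R -> R^o := valL_ (0 : R^o) f.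

Definition convex_on (I : set R) (f : I -> R^o) := convex_function I (ext f).

Definition linear_sublattice (I : set R) (D : set (I -> R^o)) :=
  [/\ submod_closed (mem D),
      forall f g, D f -> D g -> D (f \max g)
    & forall f g, D f -> D g -> D (f \min g)].

Definition positive_linear_on (I J : set R) (D : set (I -> R^o))
    (T : (I -> R^o) -> (J -> R^o)) :=
  (forall (a : R) (f g : I -> R^o), D f -> D g ->
     T (a *: f + g) = a *: T f + T g) /\
  (forall f, D f -> (forall t, 0 <= f t) -> forall x, 0 <= T f x).

(* f_{a,x}; for I an interval, x in I and a in [0, 1], the argument of ext f  *)
(* is always in I.                                                            *)
Definition dilation (I : set R) (f : I -> R^o) (a x : R) : I -> R^o :=
  fun t => ext f (a * \val t + (1 - a) * x).

Definition restriction (I J : set R) (f : I -> R^o) : J -> R^o :=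
  fun x => ext f (\val x).

(* The sequence (L_p)_{p >= 1}, completed by L_0(f) := f_{|J}; the value L 0  *)
(* is ignored.                                                                *)
Definition with_L0 (I J : set R) (L : nat -> (I -> R^o) -> (J -> R^o))
    (p : nat) : (I -> R^o) -> (J -> R^o) :=
  if p is 0%N then @restriction I J else L p.

Definition L_lambda (I J : set R) (L : nat -> (I -> R^o) -> (J -> R^o))
    (lambda : J -> R) (n : nat) (f : I -> R^o) : J -> R^o :=
  fun x => \sum_(0 <= p < n.+1)
    'C(n, p)%:R * lambda x ^+ p * (1 - lambda x) ^+ (n - p) *
    with_L0 L p (dilation f (p%:R / n%:R) (\val x)) x.

Definition decreasing_from1 (J : set R) (h : nat -> (J -> R^o)) :=
  forall n, (1 <= n)%N -> forall x, h n.+1 x <= h n x.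

End Definitions.

Section Facts.
Context {R : realType} (I : set R).
Implicit Types f : I -> R^o.

Lemma ext_val f (t : I) : ext f (\val t) = f t.
Proof. by rewrite /ext /valL_ /= oinv_set_val valK. Qed.

Lemma dilation_arg (a x : R) (t : I) : is_interval I -> I x -> 0 <= a <= 1 ->
  I (a * \val t + (1 - a) * x).
Proof.
move=> I_itv Ix /andP[a0 a1].
have It : I (\val t) by exact: set_valP.
have [tx|/ltW xt] := leP (\val t) x; [apply: (I_itv _ _ It Ix)|apply: (I_itv _ _ Ix It)];
  by apply/andP; split; nra.
Qed.

Lemma convex_onE f : is_interval I ->
  convex_on f <->
  forall (x y z : I) (a : R), 0 <= a <= 1 ->
    \val z = a * \val x + (1 - a) * \val y ->
    f z <= a * f x + (1 - a) * f y.
Proof.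
move=> I_itv; split=> [cf x y z a /andP[a0 a1] zE|cf t x y /set_mem Ix /set_mem Iy].
  have a1' : Itv.spec (@Itv.num_sem R) (Itv.Real `[0%Z, 1%Z]) a.
    by rewrite /= /Itv.num_sem/= realE a0/= in_itv/= a0 a1.
  have := cf (Itv.mk a1') (\val x) (\val y)
    (mem_set (set_valP x)) (mem_set (set_valP y)).
  have -> : conv (Itv.mk a1') (\val x : convex_lmodType R^o) (\val y) = \val z.
    by rewrite zE.
  by rewrite !ext_val.
have t01 : 0 <= t%:num <= 1 by rewrite ge0 le1.
pose x' : I := SigSub (mem_set Ix); pose y' : I := SigSub (mem_set Iy).
have Iz := dilation_arg x' I_itv Iy t01; pose z' : I := SigSub (mem_set Iz).
have := cf x' y' z' _ t01 erefl.
by rewrite -(ext_val f x') -(ext_val f y') -(ext_val f z').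
Qed.

End Facts.

(* Main.v *)
Require Import Defs.
From mathcomp Require Import all_boot all_order all_algebra.
From mathcomp Require Import all_classical all_reals all_analysis.
From mathcomp Require Import ring.
Import Order.TTheory GRing.Theory Num.Theory.
Import numFieldNormedType.Exports.

Local Open Scope classical_set_scope.
Local Open Scope ring_scope.

(** The whole argument is a comparison of weights.  Multiplying the n-th
    binomial average by l + (1 - l) = 1 rewrites it as an average against the
    binomial weights of order n.+1 ([binomial_average_degree_elevation]: this
    is the degree elevation of Bernstein polynomials), in which the p-th
    coefficient is
      (n+1-p)/(n+1) L_p(f_{p/n,x})(x) + p/(n+1) L_{p-1}(f_{(p-1)/n,x})(x).
    The weights being nonnegative, it is enough to bound below each of these
    coefficients by L_p(f_{p/(n+1),x})(x).  Two facts give that bound: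
    - L_{p-1} dominates L_p on the convex function f_{(p-1)/n,x}.  For p > 1
      this is the hypothesis; for p = 1 the function is the constant f(x),
      on which L_0 and L_1 agree;
    - p/(n+1) is the barycenter of p/n and (p-1)/n with weights (n+1-p)/(n+1)
      and p/(n+1), so that convexity of f bounds f_{p/(n+1),x} by the same
      combination of f_{p/n,x} and f_{(p-1)/n,x}, and L_p is monotone.
    At p = n+1 the function f_{(n+1)/n,x} lies outside the scope of the second
    fact, but its weight is 0 and only the first fact is used.               *)

Section BinomialAverage.
Context {R : realType}.

Lemma binS_down (n p : nat) :
  'C(n.+1, p)%:R * ((n.+1 - p)%:R / n.+1%:R) = 'C(n, p)%:R :> R.
Proof.
by rewrite mulrA -natrM mulnC -mul_bin_down natrM mulrC mulKf.
Qed.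

Lemma binS_diag (n p : nat) :
  'C(n.+1, p.+1)%:R * (p.+1%:R / n.+1%:R) = 'C(n, p)%:R :> R.
Proof.
by rewrite mulrA -natrM mulnC -mul_bin_diag natrM mulrC mulKf.
Qed.

(** Pascal's rule in weighted form: 'C(n, p) and, for p > 0, 'C(n, p.-1) are the
    fractions (n.+1 - p) / n.+1 and p / n.+1 of 'C(n.+1, p).  The meaningless values
    [u n.+1] and, at p = 0, [u p.-1] occur with coefficient 0. *)
Lemma binomial_average_degree_elevation (l : R) (u : nat -> R) (n : nat) :
  \sum_(0 <= p < n.+1) 'C(n, p)%:R * l ^+ p * (1 - l) ^+ (n - p) * u p =
  \sum_(0 <= p < n.+2) 'C(n.+1, p)%:R * l ^+ p * (1 - l) ^+ (n.+1 - p) *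
    ((n.+1 - p)%:R / n.+1%:R * u p + p%:R / n.+1%:R * u p.-1).
Proof.
under [RHS]eq_bigr do rewrite mulrDr.
rewrite big_split/= [X in _ = X + _]big_nat_recr//= subnn !mul0r mulr0 addr0.
rewrite [X in _ = _ + X]big_nat_recl//= !mul0r mulr0 add0r -big_split/=.
apply: eq_big_nat => p /andP[_]; rewrite ltnS => pn.
have downE := binS_down n p; have diagE := binS_diag n p.
rewrite subSS; rewrite subSn// in downE *; rewrite !exprS.
set b := 'C(n.+1, p.+1)%:R in diagE *; set s := _ / _ in diagE *.
set a := 'C(n.+1, p)%:R in downE *; set r := _ / _ in downE *.
transitivity (a * r * (l ^+ p * (1 - l) * (1 - l) ^+ (n - p) * u p) +
              b * s * (l * l ^+ p * (1 - l) ^+ (n - p) * u p)); last ring.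
by rewrite downE diagE; ring.
Qed.

Lemma ler_binomial_average (l : R) (u v : nat -> R) (n : nat) : 0 <= l <= 1 ->
  (forall p, (p <= n)%N -> u p <= v p) ->
  \sum_(0 <= p < n.+1) 'C(n, p)%:R * l ^+ p * (1 - l) ^+ (n - p) * u p <=
  \sum_(0 <= p < n.+1) 'C(n, p)%:R * l ^+ p * (1 - l) ^+ (n - p) * v p.
Proof.
move=> /andP[l0 l1] uv; apply: ler_sum_nat => p /andP[_]; rewrite ltnS => pn.
by rewrite ler_wpM2l ?uv// !mulr_ge0 ?exprn_ge0 ?subr_ge0.
Qed.

End BinomialAverage.

Section PositiveOperators.
Context {R : realType} {I J : set R} {D : set (I -> R^o)}.
Hypothesis D_sub : submod_closed (mem D).

Lemma submod_lin (a : R) (f g : I -> R^o) : D f -> D g -> D (a *: f + g).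
Proof. by case: D_sub => _ DS Df Dg; apply/set_mem/DS; apply/mem_set. Qed.

Lemma submodZ (a : R) (f : I -> R^o) : D f -> D (a *: f).
Proof.
by case: D_sub => D0 _ Df; rewrite -[_ *: _]addr0; apply/submod_lin/set_mem.
Qed.

Context {T : (I -> R^o) -> (J -> R^o)}.
Hypothesis T_pos_lin : positive_linear_on D T.

Lemma positive_linear_mono (f g : I -> R^o) (x : J) : D f -> D g ->
  (forall t, f t <= g t) -> T f x <= T g x.
Proof.
case: T_pos_lin => T_lin T_pos Df Dg fg.
have : 0 <= T ((-1) *: f + g) x.
  apply: T_pos => [|t]; first exact: submod_lin.
  by rewrite fctE scaleN1r addrC subr_ge0.
by rewrite T_lin// fctE scaleN1r addrC subr_ge0.
Qed.

Lemma positive_linear_comb (a b : R) (f g : I -> R^o) (x : J) : D f -> D g ->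
  T (a *: f + b *: g) x = a * T f x + b * T g x.
Proof.
case: T_pos_lin => T_lin _ Df Dg.
have T0 : T 0 = 0.
  by rewrite -[X in T X](addNr f) -scaleN1r T_lin// scaleN1r addNr.
have D0 : D 0 by case: D_sub => /set_mem.
rewrite T_lin//; last exact: submodZ.
by rewrite -[b *: g]addr0 T_lin// T0 addr0.
Qed.

Lemma positive_linear_cst (c : R) : D (fun=> 1) -> T (fun=> 1) = (fun=> 1) ->
  T (fun=> c) = (fun=> c).
Proof.
move=> D1 T1; apply/funext => x.
have -> : (fun=> c) = c *: (fun=> 1) + 0 *: (fun=> 1) :> (I -> R^o).
  by apply/funext => t; rewrite !fctE scale0r addr0 /GRing.scale/= mulr1.
by rewrite positive_linear_comb// T1; ring.
Qed.

End PositiveOperators.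

Section Dilation.
Context {R : realType} {I : set R}.
Hypothesis I_itv : is_interval I.
Implicit Types (f : I -> R^o) (a b s x : R).

(** Membership in [I] is bundled in the arguments of [convex_onE]; this is the
    same inequality at plain reals. *)
Lemma convex_on_ext f x y s : convex_on f -> I x -> I y -> 0 <= s <= 1 ->
  ext f (s * x + (1 - s) * y) <= s * ext f x + (1 - s) * ext f y.
Proof.
move=> /(convex_onE _ I_itv) cf Ix Iy s01.
pose x' : I := SigSub (mem_set Ix); pose y' : I := SigSub (mem_set Iy).
have Iz := dilation_arg x' I_itv Iy s01; pose z' : I := SigSub (mem_set Iz).
have := cf x' y' z' s s01 erefl.
by rewrite -(ext_val f x') -(ext_val f y') -(ext_val f z').
Qed.

Lemma convex_dilation f a x : convex_on f -> I x -> 0 <= a <= 1 ->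
  convex_on (dilation f a x).
Proof.
move=> cf Ix a01; apply/(convex_onE _ I_itv) => u v w s s01 wE.
rewrite /dilation wE.
rewrite (_ : _ + _ = s * (a * \val u + (1 - a) * x) +
  (1 - s) * (a * \val v + (1 - a) * x)); last ring.
by apply: convex_on_ext => //; exact: dilation_arg.
Qed.

(** For fixed [x] and [t], the point at which [dilation f a x t] evaluates [f]
    is affine in [a]. *)
Lemma dilation_convex_ratio f a b s x (t : I) : convex_on f -> I x ->
  0 <= a <= 1 -> 0 <= b <= 1 -> 0 <= s <= 1 ->
  dilation f (s * a + (1 - s) * b) x t <=
  s * dilation f a x t + (1 - s) * dilation f b x t.
Proof.
move=> cf Ix a01 b01 s01; rewrite /dilation.
rewrite (_ : _ + _ = s * (a * \val t + (1 - a) * x) +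
  (1 - s) * (b * \val t + (1 - b) * x)); last ring.
by apply: convex_on_ext => //; exact: dilation_arg.
Qed.

Lemma dilation0 f x : dilation f 0 x = (fun=> ext f x).
Proof. by apply/funext => t; rewrite /dilation; congr ext; ring. Qed.

End Dilation.

Theorem proposition3p1 (R : realType) (I J : set R)
    (I_itv : is_interval I) (J_itv : is_interval J) (JI : J `<=` I)
    (D : set (I -> R^o))
    (D_cont : D `<=` @continuous_functions R I)
    (D_lat : linear_sublattice D)
    (D_one : D (fun=> 1))
    (D_e1 : D (fun t => \val t))
    (D_dil : forall f (x a : R), D f -> I x -> 0 <= a <= 1 ->
       D (dilation f a x))
    (L : nat -> (I -> R^o) -> (J -> R^o))
    (L_pos_lin : forall n, (1 <= n)%N -> positive_linear_on D (L n))
    (L_one : forall n, (1 <= n)%N -> L n (fun=> 1) = (fun=> 1))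
    (lambda : J -> R) (lambda01 : forall x, 0 <= lambda x <= 1)
    (L_decr : forall f, D f -> convex_on f ->
       decreasing_from1 (fun n => L n f)) :
  forall f, D f -> convex_on f ->
    decreasing_from1 (fun n => L_lambda L lambda n f).
Proof.
move=> f Df cf n n_gt0 x; rewrite /L_lambda.
rewrite [leRHS]binomial_average_degree_elevation.
apply: ler_binomial_average => // -[_|p].
  (* at p = 0 all the dilation ratios vanish and both sides are f(x) *)
  by rewrite subn0 divff ?pnatr_eq0// !mul0r mul1r addr0.
rewrite ltnS => pn; have [D_sub _ _] := D_lat.
have Ix : I (\val x) by apply: JI; exact: set_valP.
have n0 : (0 : R) < n%:R by rewrite ltr0n.
have n10 : (0 : R) < n.+1%:R by rewrite ltr0n.
have ratio01 q m : (q <= m)%N -> (0 < m)%N -> 0 <= (q%:R / m%:R : R) <= 1.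
  by move=> qm m0; rewrite divr_ge0//= ler_pdivrMr ?ltr0n// mul1r ler_nat.
have pn01 := ratio01 p n pn n_gt0.
set h := dilation f (p%:R / n%:R) (\val x).
have Dh : D h by exact: D_dil.
have decr_p : L p.+1 h x <= with_L0 L p h x.
  rewrite /h; case: (posnP p) => [->|p_gt0].
    (* with ratio 0 the dilation is constant, and L 1 fixes constants *)
    rewrite mul0r dilation0 (positive_linear_cst D_sub (L_pos_lin _ _))//.
      set c : R^o := ext f _; pose y : I := SigSub (mem_set Ix).
      by rewrite [leRHS](ext_val (fun=> c) y).
    exact: L_one.
  by rewrite -(prednK p_gt0)/=; apply: L_decr => //; rewrite ?prednK//;
    exact: convex_dilation.
rewrite subSS /=.
have q0 : 0 <= (p.+1%:R / n.+1%:R : R) by rewrite divr_ge0.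
have [np|np] := leqP n p.
  (* p = n: the ratio p.+1 / n exceeds 1, but it carries the weight 0 *)
  have pE : p = n by apply/eqP; rewrite eqn_leq pn.
  move: decr_p; rewrite /h pE subnn !mul0r add0r !divff ?lt0r_neq0//.
  by rewrite mul1r.
apply: le_trans (_ : (n - p)%:R / n.+1%:R *
  L p.+1 (dilation f (p.+1%:R / n%:R) (\val x)) x +
  p.+1%:R / n.+1%:R * L p.+1 h x <= _); last by rewrite lerD2l ler_wpM2l.
have D_g := D_dil _ _ _ Df Ix (ratio01 _ _ np n_gt0).
rewrite -(positive_linear_comb D_sub (L_pos_lin _ _))//.
apply: (positive_linear_mono D_sub (L_pos_lin _ _)) => // [||t].
- by apply: D_dil => //; exact: ratio01.
- by apply: submod_lin => //; exact: submodZ.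
(* p.+1 / n.+1 is both the weight of h and the barycenter of the two ratios *)
have sE : p.+1%:R / n.+1%:R = 1 - (n - p)%:R / n.+1%:R :> R.
  rewrite natrB; last exact: ltnW.
  by rewrite -!natr1; field; rewrite natr1 lt0r_neq0.
have ratioE : p.+1%:R / n.+1%:R = (n - p)%:R / n.+1%:R * (p.+1%:R / n%:R) +
    (1 - (n - p)%:R / n.+1%:R) * (p%:R / n%:R) :> R.
  rewrite natrB; last exact: ltnW.
  by rewrite -!natr1; field; rewrite natr1 !lt0r_neq0.
rewrite !fctE [X in dilation _ X _ _ <= _]ratioE sE.
apply: dilation_convex_ratio => //.
- exact: ratio01.
- by apply: ratio01 => //; rewrite (leq_trans (leq_subr _ _)).
Qed.
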